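(* Let $n\ge 1$ be an integer and $c\in\mathbb{R}$. Let $x=(x_1,\ldots,x_n)$ be a dataset that maximizes $\mathrm{var}(y)$ among all $y\in[0,1]^n$ with $\bar{y}=c$ (that is, $x\in[0,1]^n$, $\bar{x}=c$, and $\mathrm{var}(y)\le \mathrm{var}(x)$ for every $y\in[0,1]^n$ with $\bar{y}=c$). Let $a$ be the fractional part of $nc$. Then $$\mathrm{var}(x)=c(1-c)-\frac{1}{n}\,a(1-a).$$
   Context: For a dataset $x=(x_1,\ldots,x_n)\in\mathbb{R}^n$, the mean is $\bar{x}=\frac{1}{n}\sum_{i=1}^n x_i$ and the variance is $\mathrm{var}(x)=\frac{1}{n}\sum_{i=1}^n (x_i-\bar{x})^2=\frac{1}{n}\sum_{i=1}^n x_i^2-\bar{x}^2$. The fractional part of a real number $t$ is $t-\lfloor t\rfloor\in[0,1)$. *)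

(* Defs.v *)
From mathcomp Require Import all_boot all_order all_algebra.
From mathcomp Require Import reals.

Set Implicit Arguments.
Unset Strict Implicit.
Unset Printing Implicit Defensive.

Import Order.TTheory GRing.Theory Num.Theory.
Local Open Scope ring_scope.

Definition mean (R : realType) (n : nat) (x : 'rV[R]_n) : R :=
  n%:R^-1 * \sum_(i < n) x 0 i.

(* The population variance, normalized by 1/n rather than 1/(n-1). *)
Definition var (R : realType) (n : nat) (x : 'rV[R]_n) : R :=
  n%:R^-1 * \sum_(i < n) (x 0 i - mean x) ^+ 2.

Definition fractional_part (R : realType) (t : R) : R :=
  t - (Num.floor t)%:~R.

(* Main.v *)
Require Import Defs.
From mathcomp Require Import all_boot all_order all_algebra.
From mathcomp Require Import reals.
From mathcomp Require Import zify ring lra.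

(** Write [S] for the sum of the entries.  Expanding squares gives
    [var x = c (1 - c) - S'/n] with [S' = \sum_i x_i (1 - x_i)] ([varE]), so at
    fixed mean maximizing the variance means minimizing [S'].

    The function [t |-> frac t * (1 - frac t)] is subadditive and coincides with
    [t (1 - t)] on the unit interval, hence [S' >= a (1 - a)], where [a] is the fractional
    part of [S = n c].  It is the maximum over the integers [k] of the parabolas
    [(t - k) (1 - (t - k))], and the bound is proved for each of these
    ([parabola_le_sum]), which allows an induction without floors.

    Equality holds for the dataset made of [floor S] ones, then one entry equal
    to [a], then zeros ([sum_staircase]): every term of [S'] vanishes there
    except [a (1 - a)]. *)

Import Order.TTheory GRing.Theory Num.Theory.
Local Open Scope ring_scope.

Lemma mean_sum (R : realType) (n : nat) (x : 'rV[R]_n) :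
  (0 < n)%N -> \sum_(i < n) x 0 i = n%:R * mean x.
Proof. by move=> n0; rewrite /mean mulVKf // pnatr_eq0 -lt0n. Qed.

Lemma varE (R : realType) (n : nat) (x : 'rV[R]_n) : (0 < n)%N ->
  var x = mean x * (1 - mean x) - n%:R^-1 * \sum_(i < n) x 0 i * (1 - x 0 i).
Proof.
move=> n0; have nz : n%:R != 0 :> R by rewrite pnatr_eq0 -lt0n.
rewrite /var; set m := mean x.
have -> : \sum_(i < n) (x 0 i - m) ^+ 2 =
    (1 - m *+ 2) * (\sum_(i < n) x 0 i) + n%:R * m ^+ 2
    - \sum_(i < n) x 0 i * (1 - x 0 i).
  have -> : n%:R * m ^+ 2 = \sum_(i < n) m ^+ 2.
    by rewrite sumr_const card_ord mulr_natl.
  by rewrite mulr_sumr -big_split -sumrB /=; apply: eq_bigr => i _; ring.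
by rewrite mean_sum // -/m; field.
Qed.

(** The induction needs the bound for all [k] at once: when the partial sum
    lies below [k], the step for [k] rests on the hypothesis for [k - 1].  With
    [p t = t (1 - t)], adding an entry [y] to [t = S - k] costs
    [p (t + y) = p t + p y - 2 t y], which settles [0 <= t], and
    [p (t + y) = p (t + 1) + p y + 2 t (1 - y)] settles [t < 0]. *)
Lemma parabola_le_sum {R : realDomainType} (s : seq R) (k : int) :
  {in s, forall t, 0 <= t <= 1} ->
  (\sum_(t <- s) t - k%:~R) * (1 - (\sum_(t <- s) t - k%:~R))
    <= \sum_(t <- s) t * (1 - t).
Proof.
elim: s k => [|y s IHs] k s01.
  (* no integer lies strictly between -1 and 0, so - k (1 + k) <= 0 *)
  rewrite !big_nil; have [k0|k0] := lerP 0 k.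
    have : 0 <= k%:~R :> R by rewrite ler0z.
    nra.
  have : k%:~R <= -1 :> R by rewrite -[-1]/((-1)%:~R) ler_int; lia.
  nra.
have /andP[y0 y1] := s01 y (mem_head y s).
have {s01}IH j := IHs j (fun t ts => s01 t (@mem_behead _ (y :: s) t ts)).
rewrite !big_cons; set S := \sum_(t <- s) t in IH *.
have [kS|Sk] := lerP k%:~R S; first by have := IH k; nra.
by have := IH (k - 1); rewrite intrB; nra.
Qed.

Definition staircase {R : pzRingType} (n k : nat) (a : R) : 'rV[R]_n :=
  \row_(i < n) if (i < k)%N then 1 else if (i == k :> nat) then a else 0.

(** When [k = n] there is no room for the entry [a], so its contribution
    [phi a] must vanish. *)
Lemma sum_staircase {R : pzRingType} (phi : R -> R) (n k : nat) (a : R) :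
  phi 0 = 0 -> (k <= n)%N -> (k = n -> phi a = 0) ->
  \sum_(i < n) phi (staircase n k a 0 i) = k%:R * phi 1 + phi a.
Proof.
move=> phi0 /subnKC; move: (n - k)%N => m <- {n} full.
under eq_bigr do rewrite mxE.
rewrite big_split_ord /=; congr (_ + _).
  under eq_bigr do rewrite ltn_ord.
  by rewrite sumr_const card_ord mulr_natl.
case: m full => [|m] full; first by rewrite big_ord0 full ?addn0.
rewrite big_ord_recl /= addn0 ltnn eqxx big1 ?addr0 // => i _.
by rewrite ltnNge leq_addr /= -[X in _ == X]addn0 eqn_add2l phi0.
Qed.

Theorem theorem1 (R : realType) (n : nat) (c : R) (x : 'rV[R]_n) (a : R)
  (hn : (1 <= n)%N)
  (hx : forall i : 'I_n, 0 <= x 0 i <= 1)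
  (hmean : mean x = c)
  (hmax : forall y : 'rV[R]_n,
     (forall i : 'I_n, 0 <= y 0 i <= 1) -> mean y = c -> var y <= var x)
  (ha : a = fractional_part (n%:R * c)) :
  var x = c * (1 - c) - n%:R^-1 * (a * (1 - a)).
Proof.
have nz : n%:R != 0 :> R by rewrite pnatr_eq0 -lt0n.
have sumx : \sum_(i < n) x 0 i = n%:R * c by rewrite mean_sum ?hmean.
apply/eqP; rewrite eq_le; apply/andP; split.
  rewrite varE // hmean lerD2l lerN2 ler_pM2l ?invr_gt0 ?ltr0n //.
  have := parabola_le_sum [seq x 0 i | i <- index_enum 'I_n]
                            (Num.floor (n%:R * c)).
  rewrite !big_map sumx ha; apply=> _ /mapP[i _ ->]; exact: hx.
have nc0 : 0 <= n%:R * c.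
  by rewrite -sumx sumr_ge0 // => i _; case/andP: (hx i).
have ncn : n%:R * c <= n%:R.
  rewrite -sumx -[n in leRHS]card_ord -sumr_const ler_sum // => i _.
  by case/andP: (hx i).
pose k := `|Num.floor (n%:R * c)|%N.
have nck : n%:R * c = k%:R + a.
  by rewrite ha /fractional_part -[k%:R]/(k%:~R) gez0_abs ?floor_ge0 // addrC subrK.
have a0 : 0 <= a by rewrite ha subr_ge0 floor_le.
have a1 : a <= 1.
  by rewrite ha lerBlDl -[X in _ + X]/(1%:~R) -intrD ltW // floorD1_gt.
have kn : (k <= n)%N by rewrite -(ler_nat R); lra.
have full : k = n -> a = 0 by move=> kE; move: nck ncn; rewrite kE; lra.
have meany : mean (staircase n k a) = c.
  apply: (mulfI nz); rewrite -mean_sum //.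
  by rewrite (sum_staircase id) // mulr1 nck.
have := hmax (staircase n k a); rewrite varE // meany.
rewrite (sum_staircase (fun t => t * (1 - t))) ?mul0r //; last first.
  by move=> /full ->; rewrite mul0r.
rewrite subrr !mulr0 add0r; apply=> // i.
by rewrite mxE; case: ifP => _; [|case: ifP => _]; rewrite ?lexx ?ler01 ?a0.
Qed.
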